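(* The second-price auction (SPA) is optimistic auto-bidding incentive compatible (OAIC) in the setting of non-uniform bidding tCPA auto-bidders. That is: for every finite set $A$ of advertisers, every finite set $Q$ of queries, all values $v_{i,j}\ge 0$ ($i\in A$, $j\in Q$), every advertiser $i\in A$ with true target $T_i>0$, every choice of fixed reported targets $T_\ell>0$ of the other advertisers $\ell\ne i$, and every report $0<T_i'\le T_i$, $$\max_{\pi\in\Pi(T_i)^{\mathrm{Eq}}}\mathrm{LW}_i(\pi)\ \ge\ \max_{\pi\in\Pi(T_i')^{\mathrm{Eq}}}\mathrm{LW}_i(\pi).$$
   Context: Setting. $A$ is a finite set of at least two advertisers and $Q$ a finite set of queries; bidder $i$ has value $v_{i,j}\ge0$ for query $j$. Each advertiser $i$ reports a target to its own auto-bidder, which then places a bid $b_{i,j}\in[0,\infty)$ on each query $j$; bids on different queries may be arbitrary and unrelated (non-uniform bidding). Second-price auction: each query $j$ is sold separately to a bidder with the highest bid on $j$ (ties broken by a fixed deterministic rule). $\pi_{i,j}\in\{0,1\}$ indicates whether $i$ wins $j$, so $\sum_{i}\pi_{i,j}=1$. If $i$ wins $j$ it pays $c_{i,j}=\max_{\ell\ne i}b_{\ell,j}$. Auto-bidder equilibrium. Let the reported targets be $(S_i)_{i\in A}$. A bid profile $(b_{i,j})$ with allocation $\pi$ and costs $c$ is an auto-bidder equilibrium if for every bidder $i$: (0) undominated bids: $b_{i,j}\ge S_i v_{i,j}$ for all $j\in Q$; (1) tCPA constraint: $\sum_{j}\pi_{i,j}c_{i,j}\le S_i\sum_j\pi_{i,j}v_{i,j}$;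 (2) stability: for every deviation of $i$ to bids $(b'_{i,j})_{j\in Q}$, all other bids being unchanged, with resulting allocation $\pi'$ and costs $c'$, at least one of the following holds: $S_i\sum_j\pi'_{i,j}v_{i,j}\le S_i\sum_j\pi_{i,j}v_{i,j}$, or $\sum_j\pi'_{i,j}c'_{i,j}>S_i\sum_j\pi'_{i,j}v_{i,j}$. With the reports of all advertisers other than $i$ fixed, $\Pi(S)^{\mathrm{Eq}}$ denotes the set of allocations of auto-bidder equilibria when advertiser $i$ reports $S$. $\mathrm{LW}_i(\pi)=T_i\sum_{j\in Q}\pi_{i,j}v_{i,j}$, where $T_i$ is the true target of $i$ (used on both sides of the inequality). Convention: the maximum over an empty set is $-\infty$. *)

(* Defs.v *)
From HB Require Import structures.
From mathcomp Require Import all_boot all_order all_algebra.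
From mathcomp Require Import boolp classical_sets reals constructive_ereal.

Set Implicit Arguments.
Unset Strict Implicit.
Unset Printing Implicit Defensive.

Import Order.TTheory GRing.Theory Num.Theory.

Local Open Scope ring_scope.

Section SecondPriceAuction.
Variables (R : realType) (A Q : finType).

(* A deterministic rule selecting, query by query, the winner from the bids on
   that query.  On non-negative bids the winner must be a highest bidder; how
   ties are broken is otherwise arbitrary, and may depend on the query and on
   the bids placed on it. *)
Definition highest_bid_rule (win : Q -> (A -> R) -> A) : Prop :=
  forall (j : Q) (x : A -> R), (forall l, 0 <= x l) ->
    forall l, x l <= x (win j x).

Definition allocation : finType := {ffun A * Q -> bool}.

Definition spa_alloc (win : Q -> (A -> R) -> A) (b : A -> Q -> R) : allocation :=
  [ffun lj => lj.1 == win lj.2 (fun l => b l lj.2)].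

(* As bids are non-negative, the default value 0 is harmless as soon as there
   are two bidders. *)
Definition spa_cost (b : A -> Q -> R) (i : A) (j : Q) : R :=
  \big[Num.max/0]_(l | l != i) b l j.

Definition total_value (v : A -> Q -> R) (pi : allocation) (i : A) : R :=
  \sum_j (pi (i, j))%:R * v i j.

Definition total_cost (win : Q -> (A -> R) -> A) (b : A -> Q -> R) (i : A) : R :=
  \sum_j (spa_alloc win b (i, j))%:R * spa_cost b i j.

Definition equilibrium (win : Q -> (A -> R) -> A) (v : A -> Q -> R)
    (S : A -> R) (b : A -> Q -> R) : Prop :=
  (forall i j, 0 <= b i j) /\
  forall i : A,
    [/\ forall j, S i * v i j <= b i j,
        total_cost win b i <= S i * total_value v (spa_alloc win b) i
      & forall d : Q -> R, (forall j, 0 <= d j) ->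
          let b' := [eta b with i |-> d] in
          S i * total_value v (spa_alloc win b') i
            <= S i * total_value v (spa_alloc win b) i
          \/ S i * total_value v (spa_alloc win b') i < total_cost win b' i].

(* Allocations of the equilibria in which advertiser i reports s and every
   other advertiser l reports T l; the value T i plays no role. *)
Definition eq_allocations (win : Q -> (A -> R) -> A) (v : A -> Q -> R)
    (T : A -> R) (i : A) (s : R) : set allocation :=
  [set pi | exists b, equilibrium win v [eta T with i |-> s] b
                      /\ pi = spa_alloc win b]%classic.

Definition LW (v : A -> Q -> R) (i : A) (Ti : R) (pi : allocation) : R :=
  Ti * total_value v pi i.

(* Maximum of LW over a set of allocations (a subset of a finite type), equal
   to -oo on the empty set. *)
Definition max_LW (v : A -> Q -> R) (i : A) (Ti : R) (P : set allocation)
    : \bar R :=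
  \big[maxe/-oo%E]_(pi in P) (LW v i Ti pi)%:E.

End SecondPriceAuction.

(* Main.v *)
(** Winners may bid arbitrarily high, which makes their queries unaffordable to
    everyone else, while losers may bid as low as [S l * v l j].  So an
    assignment of queries to winners is an equilibrium allocation as soon as
    each winner can pay the losers' undominated bids [S l * v l j].  Given an
    equilibrium at the lower report, let [i] keep its queries, whose cost is
    covered because losers' bids were already at least [T l * v l j], and give
    every other query to an advertiser maximizing [S l * v l j], who can pay for
    it query by query. *)
Require Import Defs.
From mathcomp Require Import all_boot all_order all_algebra.
From mathcomp Require Import boolp classical_sets reals constructive_ereal.
Import Order.TTheory GRing.Theory Num.Theory.
Local Open Scope ring_scope.

Section SecondPriceEquilibria.
Set Implicit Arguments.
Unset Strict Implicit.
Variables (R : realType) (A Q : finType).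
Variables (win : Q -> (A -> R) -> A) (v : A -> Q -> R).
Hypotheses (hwin : highest_bid_rule win) (hv : forall l j, 0 <= v l j).
Implicit Types (S : A -> R) (b : A -> Q -> R) (w : Q -> A) (i l : A) (j : Q).

Lemma spa_cost_ge0 b i j : 0 <= spa_cost b i j.
Proof. exact: bigmax_ge_id. Qed.

Lemma le_bid_spa_cost b i l j : l != i -> b l j <= spa_cost b i j.
Proof. by move=> li; apply: (le_bigmax_cond _ (fun l => b l j)). Qed.

Lemma spa_cost_le b i j c :
  0 <= c -> (forall l, l != i -> b l j <= c) -> spa_cost b i j <= c.
Proof. by move=> c0 bc; apply: bigmax_le. Qed.

Lemma le_spa_cost b b' i j :
  (forall l, l != i -> b l j <= b' l j) -> spa_cost b i j <= spa_cost b' i j.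
Proof.
move=> bb'; apply: spa_cost_le => [|l li]; first exact: spa_cost_ge0.
exact: le_trans (bb' l li) (le_bid_spa_cost _ _ li).
Qed.

Definition winner_alloc w : allocation A Q := [ffun lj => lj.1 == w lj.2].

Definition shielded_bids S (M : R) w l j : R :=
  if l == w j then M else S l * v l j.

Lemma total_value_le (pi pi' : allocation A Q) l :
  (forall j, pi (l, j) -> pi' (l, j)) ->
  total_value v pi l <= total_value v pi' l.
Proof.
move=> sub; apply: ler_sum => j _; apply: ler_wpM2r => //.
by rewrite ler_nat; case: (pi _) (sub j) => // ->.
Qed.

(** A deviation winning no new query gains no value, and one winning a query of another bidder pays
    at least the shield [M], more than its target times all its values. *)
Lemma winner_alloc_equilibrium S w :
  (forall l, 0 < S l) ->
  (forall l, \sum_j (l == w j)%:R * spa_cost (fun k j => S k * v k j) l j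
               <= S l * total_value v (winner_alloc w) l) ->
  exists2 b, equilibrium win v S b & spa_alloc win b = winner_alloc w.
Proof.
move=> S0 afford.
pose W l := S l * \sum_j v l j.
have W0 l : 0 <= W l by rewrite mulr_ge0 ?(ltW (S0 l)) ?sumr_ge0.
(* The summand 1 makes [M] strictly exceed every [W l]: deviators then violate tCPA strictly, and no
   loser ties with a shield. *)
pose M := 1 + \sum_l W l.
have WM l : W l < M.
  by rewrite /M (bigD1 l) //= addrCA ltrDl ltr_wpDr ?ltr01 ?sumr_ge0.
have SvM l j : S l * v l j < M.
  apply: le_lt_trans (WM l); rewrite ler_pM2l ?S0 //.
  by rewrite (bigD1 j) //= lerDl sumr_ge0.
have M0 : 0 <= M by rewrite addr_ge0 ?ler01 ?sumr_ge0.
have Sv0 l j : 0 <= S l * v l j by rewrite mulr_ge0 ?(ltW (S0 l)).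
pose b := shielded_bids S M w.
have b0 l j : 0 <= b l j by rewrite /b /shielded_bids; case: ifP.
(* The only bid of [M] on [j] is that of [w j] and all others are smaller, so the tie-breaking rule
   is irrelevant. *)
have winE j : win j (b^~ j) = w j.
  apply/eqP/negPn/negP => ne.
  have := @hwin j (fun k => b k j) (fun k => b0 k j) (w j).
  by rewrite /b /shielded_bids eqxx (negPf ne) leNgt SvM.
have allocE : spa_alloc win b = winner_alloc w.
  by apply/ffunP => lj; rewrite !ffunE winE.
exists b => //; split=> // l; split.
- by move=> j; rewrite /b /shielded_bids; case: ifP => // _; exact: ltW.
- rewrite allocE; apply: le_trans (afford l); rewrite /total_cost allocE.
  apply: ler_sum => j _; rewrite ffunE /=.
  have [->|_] := eqVneq l (w j); last by rewrite !mul0r.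
  rewrite !mul1r; apply: le_spa_cost => k kw.
  by rewrite /b /shielded_bids (negPf kw).
- move=> d d0 b'; rewrite allocE.
  have [sub|] := pselect (forall j, spa_alloc win b' (l, j) -> l = w j).
    left; rewrite ler_pM2l ?S0 //; apply: total_value_le => j /sub lw.
    by rewrite ffunE /= -lw.
  move=> /existsNP[j /not_implyP[lj /eqP lw]]; right.
  apply: (@le_lt_trans _ _ (W l)).
    rewrite ler_pM2l ?S0 //; apply: ler_sum => k _.
    by case: (spa_alloc _ _ _); rewrite ?mul1r ?mul0r.
  apply: lt_le_trans (WM l) _; rewrite /total_cost (bigD1 j) //= lj mul1r.
  apply: (@le_trans _ _ (spa_cost b' l j)).
    have wl : w j != l by rewrite eq_sym.
    have := le_bid_spa_cost b' j wl.
    by rewrite /b' /= eq_sym (negPf lw) /b /shielded_bids eqxx.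
  rewrite lerDl sumr_ge0 // => k _.
  by rewrite mulr_ge0 ?ler0n ?spa_cost_ge0.
Qed.

Lemma equilibrium_raise_target S i (s : R) b :
  (forall l, 0 < S l) -> 0 < s -> s <= S i ->
  equilibrium win v [eta S with i |-> s] b ->
  exists2 b', equilibrium win v S b' &
    total_value v (spa_alloc win b) i <= total_value v (spa_alloc win b') i.
Proof.
move=> S0 s0 sS [b0 eqb].
pose best j := [arg max_(l > i) (S l * v l j)]%O.
have bestP j l : S l * v l j <= S (best j) * v (best j) j.
  by rewrite /best; case: Order.TotalTheory.arg_maxP => // k _; apply.
pose X j : bool := spa_alloc win b (i, j).
pose w j := if X j then i else best j.
have Sv0 l j : 0 <= S l * v l j by rewrite mulr_ge0 ?(ltW (S0 l)).
pose low k j := S k * v k j.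
have cost_best j : spa_cost low (best j) j <= S (best j) * v (best j) j.
  by apply: spa_cost_le => // l _; apply: bestP.
(* Rivals report the same targets in both profiles, so their old bids dominate [low]; the old tCPA
   bound at [s] then relaxes to [S i]. *)
have keep : \sum_j (X j)%:R * spa_cost low i j
            <= \sum_j (X j)%:R * (S i * v i j).
  have [_ + _] := eqb i; rewrite /= eqxx => costb.
  apply: (@le_trans _ _ (total_cost win b i)).
    apply: ler_sum => j _; rewrite ler_wpM2l ?ler0n //.
    apply: le_spa_cost => l li.
    by have [/(_ j) + _ _] := eqb l; rewrite /= (negPf li).
  apply: le_trans costb _.
  apply: (@le_trans _ _ (S i * total_value v (spa_alloc win b) i)).
    by rewrite ler_wpM2r // sumr_ge0 // => j _; rewrite mulr_ge0 ?ler0n.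
  by rewrite mulr_sumr; apply: ler_sum => j _; rewrite mulrCA.
have [l|b' eqb' allocE] := winner_alloc_equilibrium S0 (w := w).
  rewrite mulr_sumr -subr_ge0 -sumrB.
  have [->{l}|li] := eqVneq l i.
    (* Kept queries are affordable only in aggregate, by [keep]; each query that [i] gains as
       [best j] adds nonnegative slack. *)
    move: keep; rewrite -subr_ge0 -sumrB => /le_trans; apply.
    apply: ler_sum => j _; rewrite ffunE /= /w.
    case: (X j); first by rewrite eqxx !mul1r.
    rewrite !mul0r subrr; have [->|_] := eqVneq i (best j).
      by rewrite !mul1r subr_ge0.
    by rewrite !mul0r mulr0 subrr.
  (* A bidder other than [i] wins only where it is [best j], so its slack is nonnegative on each
     query separately. *)
  apply: sumr_ge0 => j _; rewrite ffunE /= /w.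
  case: (X j); first by rewrite (negPf li) !mul0r mulr0 subrr.
  have [->|_] := eqVneq l (best j); last by rewrite !mul0r mulr0 subrr.
  by rewrite !mul1r subr_ge0.
exists b' => //; rewrite allocE; apply: total_value_le => j Xj.
by rewrite ffunE /= /w /X Xj.
Qed.

End SecondPriceEquilibria.

Theorem theorem2 (R : realType) (A Q : finType) (hA : (2 <= #|A|)%N)
    (win : Q -> (A -> R) -> A) (hwin : highest_bid_rule win)
    (v : A -> Q -> R) (hv : forall l j, 0 <= v l j)
    (i : A) (Ti : R) (hTi : 0 < Ti)
    (T : A -> R) (hT : forall l, l != i -> 0 < T l)
    (Ti' : R) (hTi' : 0 < Ti') (hle : Ti' <= Ti) :
  (max_LW v i Ti (eq_allocations win v T i Ti)
     >= max_LW v i Ti (eq_allocations win v T i Ti'))%E.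
Proof.
apply: bigmax_le => [|pi]; first exact: leNye.
rewrite inE => -[b [eqb ->]].
(* With the true target built into [S], all targets are positive and the lower report is a single
   update of [S] at [i]. *)
pose S : A -> R := [eta T with i |-> Ti].
have S0 l : 0 < S l by rewrite /S /=; have [//|/hT] := eqVneq l i.
have SE : [eta T with i |-> Ti'] = [eta S with i |-> Ti'] :> (A -> R).
  by apply: funext => l; rewrite /S /=; case: ifP.
rewrite SE in eqb.
have sS : Ti' <= S i by rewrite /S /= eqxx.
have [b' eqb' le_bb'] := equilibrium_raise_target hwin hv S0 hTi' sS eqb.
apply: (bigmax_sup (spa_alloc win b')); first by rewrite inE; exists b'.
by rewrite lee_fin /LW ler_pM2l.
Qed.
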